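(* Let $f$ be a function satisfying property $P^{*}$, and let $\mathcal{H}_{n,\kappa}^{\beta_0}$ be the set of connected graphs of order $n$ with vertex connectivity $\kappa$ and independence number $\beta_0$. Then for any graph $G\in\mathcal{H}_{n,\kappa}^{\beta_0}$, $$\rho_{f}(G)\le \rho_{f}\Bigl(K_{\kappa}\vee\bigl(K_1\cup (K_{n-\kappa-\beta_0}\vee (\beta_0-1)K_1)\bigr)\Bigr),$$ with equality if and only if $G\cong K_{\kappa}\vee\bigl(K_1\cup (K_{n-\kappa-\beta_0}\vee (\beta_0-1)K_1)\bigr)$.
   Context: All graphs are simple, finite and undirected. $K_m$ is the complete graph on $m$ vertices ($K_0$ is the graph with no vertices). $G_1\cup G_2$ is the disjoint union of graphs, $mK_1$ is the edgeless graph on $m$ vertices (no vertices if $m=0$), and the join $G_1\vee G_2$ is obtained from $G_1\cup G_2$ by adding all edges between vertices of $G_1$ and vertices of $G_2$. For $W\subseteq V(G)$, $G-W$ is the graph obtained from $G$ by deleting the vertices in $W$. If $G$ is connected, a set $W\subseteq V(G)$ is called a vertex cut set of $G$ if $G-W$ is disconnected or is a single isolated vertex; the vertex connectivity $\kappa(G)$ is the minimum cardinality of a vertex cut set of $G$ (so $\kappa(K_n)=n-1$). The independence number $\beta_0(G)$ is the maximum number of pairwise non-adjacent vertices of $G$. Weighted adjacency matrix: let $f(x,y)$ be a real-valued symmetric function ($f(x,y)=f(y,x)$) defined for real arguments $x,y\ge 1$. For a graph $G$ with vertices $v_1,\dots,v_n$ of degrees $d_1,\dots,d_n$, $A_f(G)$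 is the $n\times n$ matrix whose $(i,j)$ entry is $f(d_i,d_j)$ if $v_i$ is adjacent to $v_j$, and $0$ otherwise. $\rho_f(G)$ denotes the spectral radius of $A_f(G)$ (the weighted spectral radius of $G$). Property $P^{*}$: the symmetric function $f$ satisfies property $P^{*}$ if (i) $f(x,y)>0$ and $f$ is increasing and convex in $x$, meaning $f_x(x,y)\ge 0$ and $f_{xx}(x,y)\ge 0$ (partial derivatives with respect to $x$, one-sided at the boundary of the domain); and (ii) whenever $x_1+y_1=x_2+y_2$ and $|x_1-y_1|>|x_2-y_2|$, one has $f(x_1,y_1)\ge f(x_2,y_2)$. *)

(* Defs.v *)
From HB Require Import structures.
From mathcomp Require Import all_boot all_order all_algebra.
From mathcomp Require Import all_classical all_reals all_analysis.
From mathcomp Require Import complex.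

Set Implicit Arguments.
Unset Strict Implicit.
Unset Printing Implicit Defensive.

Import Order.TTheory GRing.Theory Num.Theory.
Import numFieldNormedType.Exports.
Local Open Scope classical_set_scope.
Local Open Scope ring_scope.

Record sgraph := SGraph {
  vertex :> finType;
  edge : rel vertex;
  edge_sym : symmetric edge;
  edge_irr : irreflexive edge }.

Definition graph_iso (G H : sgraph) : Prop :=
  exists2 h : G -> H, bijective h & {mono h : x y / edge x y}.

Section Constructions.

Definition complete_rel (m : nat) : rel 'I_m := fun x y => x != y.

Fact complete_sym m : symmetric (@complete_rel m).
Proof. by move=> x y; rewrite /complete_rel eq_sym. Qed.

Fact complete_irr m : irreflexive (@complete_rel m).
Proof. by move=> x; rewrite /complete_rel eqxx. Qed.

Definition complete_graph (m : nat) : sgraph :=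
  SGraph (@complete_sym m) (@complete_irr m).

Definition edgeless_rel (m : nat) : rel 'I_m := fun _ _ => false.

Fact edgeless_sym m : symmetric (@edgeless_rel m).
Proof. by []. Qed.

Fact edgeless_irr m : irreflexive (@edgeless_rel m).
Proof. by []. Qed.

Definition edgeless_graph (m : nat) : sgraph :=
  SGraph (@edgeless_sym m) (@edgeless_irr m).

Variables G1 G2 : sgraph.

Definition sum_rel (cross : bool) : rel (G1 + G2)%type := fun u v =>
  match u, v with
  | inl x, inl y => edge x y
  | inr x, inr y => edge x y
  | _, _ => cross
  end.

Fact sum_sym c : symmetric (sum_rel c).
Proof. by case=> x [] y //=; apply: edge_sym. Qed.

Fact sum_irr c : irreflexive (sum_rel c).
Proof. by case=> x /=; apply: edge_irr. Qed.

Definition disjoint_union : sgraph := SGraph (sum_sym false) (sum_irr false).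

Definition graph_join : sgraph := SGraph (sum_sym true) (sum_irr true).

End Constructions.

Section Deletion.
Variables (G : sgraph) (W : {set G}).

Definition del_rel : rel {x : G | x \notin W} := fun x y => edge (val x) (val y).

Fact del_sym : symmetric del_rel.
Proof. by move=> x y; apply: edge_sym. Qed.

Fact del_irr : irreflexive del_rel.
Proof. by move=> x; apply: edge_irr. Qed.

Definition delete : sgraph := SGraph del_sym del_irr.

End Deletion.

(* The graph with no vertices is neither connected nor disconnected. *)
Definition connected_graph (G : sgraph) : bool :=
  (0 < #|G|)%N && [forall x : G, forall y : G, connect (@edge G) x y].

Definition disconnected_graph (G : sgraph) : bool :=
  [exists x : G, exists y : G, ~~ connect (@edge G) x y].

Definition vertex_cut (G : sgraph) (W : {set G}) : bool :=
  disconnected_graph (delete W) || (#|delete W| == 1%N).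

(* A nonempty graph has a vertex cut set with #|G|.-1 elements (all vertices
   but one), so the default value #|G| of the minimum is never attained. *)
Definition vertex_connectivity (G : sgraph) : nat :=
  \big[minn/#|G|]_(W : {set G} | vertex_cut W) #|W|.

Definition independent (G : sgraph) (S : {set G}) : bool :=
  [forall x in S, forall y in S, ~~ edge x y].

Definition independence_number (G : sgraph) : nat :=
  \max_(S : {set G} | independent S) #|S|.

Definition conn_indep_class (n kappa beta0 : nat) (G : sgraph) : Prop :=
  [/\ #|G| = n, connected_graph G, vertex_connectivity G = kappa
    & independence_number G = beta0].

(* The subtractions never truncate when the class above is nonempty. *)
Definition extremal_graph (n kappa beta0 : nat) : sgraph :=
  graph_join (complete_graph kappa)
    (disjoint_union (complete_graph 1)
      (graph_join (complete_graph (n - kappa - beta0)) (edgeless_graph (beta0 - 1)))).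

Definition degree (G : sgraph) (x : G) : nat := #|[pred y | edge x y]|.

Section Weighted.
Variable R : realType.

Definition weighted_adjacency (f : R -> R -> R) (G : sgraph) : 'M[R]_#|G| :=
  \matrix_(i, j) (if edge (enum_val i) (enum_val j)
    then f (degree (enum_val i))%:R (degree (enum_val j))%:R else 0).

(* Largest modulus of a complex eigenvalue; for a matrix of positive size this
   set is finite and nonempty, so the supremum is a maximum. *)
Definition spectral_radius (m : nat) (A : 'M[R]_m) : R :=
  sup [set ComplexField.Normc.normc z | z in
    [set z : R[i] | eigenvalue (map_mx (real_complex R) A) z]].

Definition weighted_spectral_radius (f : R -> R -> R) (G : sgraph) : R :=
  spectral_radius (weighted_adjacency f G).

(* [l] is the derivative at [x] of [g] restricted to [1, +oo[: the ordinary
   derivative if 1 < x, the right derivative if x = 1. *)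
Definition is_derive_ge1 (g : R -> R) (x l : R) : Prop :=
  (g z - g x) / (z - x) @[z --> within [set z | 1 <= z] x^'] --> l.

(* Weight functions are total, but only their values on [1, +oo[^2 matter. *)
Definition symmetric_ge1 (f : R -> R -> R) : Prop :=
  forall x y : R, 1 <= x -> 1 <= y -> f x y = f y x.

Definition property_Pstar (f : R -> R -> R) : Prop :=
  [/\ forall x y : R, 1 <= x -> 1 <= y -> 0 < f x y,
      exists fx fxx : R -> R -> R, forall x y : R, 1 <= x -> 1 <= y ->
        [/\ is_derive_ge1 (f^~ y) x (fx x y), 0 <= fx x y,
            is_derive_ge1 (fx^~ y) x (fxx x y) & 0 <= fxx x y]
    & forall x1 y1 x2 y2 : R, 1 <= x1 -> 1 <= y1 -> 1 <= x2 -> 1 <= y2 ->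
        x1 + y1 = x2 + y2 -> `|x2 - y2| < `|x1 - y1| -> f x2 y2 <= f x1 y1].

End Weighted.

(* Main.v *)
Require Import Defs.
From mathcomp Require Import all_boot all_order all_algebra.
From mathcomp Require Import all_classical all_reals all_analysis.
From mathcomp Require Import perm complex.
From mathcomp Require Import ring lra zify.

(* Say that [H] dominates [G] when rho_f(G) <= rho_f(H), with equality only for
   isomorphic graphs if [G] is connected.  Comparing the quadratic forms of the
   two weighted adjacency matrices at a Perron vector x of [G] shows that [G] is
   dominated by every graph obtained by adding edges (monotonicity of f), and by
   its image under Kelmans' operation, which moves the private neighbours of a
   vertex v to a vertex u.  In the latter case one may assume x_v <= x_u, since
   exchanging u and v gives isomorphic graphs; convexity of f then handles the
   common neighbours of u and v, and (ii) of P* handles the edge uv.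

   Let W be a minimum vertex cut and S a maximum independent set of [G], and let
   A, B be two sides of G - W.  If S meets A in a, let some b in B gain the
   private neighbours of a: afterwards a is adjacent to nothing in A, B or S, so
   the graph embeds in the extremal one, as beta0 <= n - kappa.  If S lies in W,
   one more Kelmans operation, from w in S to a in A, lets w replace a in A and
   reduces to the previous case. *)

Set Implicit Arguments.
Unset Strict Implicit.
Unset Printing Implicit Defensive.

Import Order.TTheory GRing.Theory Num.Theory.
Import numFieldNormedType.Exports.
Local Open Scope ring_scope.

(** * Monotone and convex functions on [1, +oo[ *)

Section DeriveGe1.
Local Open Scope classical_set_scope.
Variable R : realType.
Implicit Types (g l : R -> R).

Lemma is_derive_ge1P g x d : is_derive_ge1 g x d ->
  forall e, 0 < e -> exists2 r, 0 < r & forall z, 1 <= z -> `|z - x| < r ->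
    z != x -> `|d - (g z - g x) / (z - x)| < e.
Proof.
move=> /cvgrPdist_lt gd e /gd [r /= r0 rP]; exists r => // z z1 zx znx.
by apply: (rP z) => //=; rewrite distrC.
Qed.

Lemma is_derive_ge1_is_derive g x d : 1 < x -> is_derive_ge1 g x d ->
  is_derive x 1 g d.
Proof.
move=> x1 /is_derive_ge1P gd.
suff gl : h^-1 *: (g (h *: 1 + x) - g x) @[h --> 0^'] --> d.
  apply: DeriveDef; first by apply/cvg_ex; exists d.
  exact: cvg_lim.
apply/cvgrPdist_lt => e /gd [r r0 rP].
(* Capping the radius at [x - 1] keeps [h + x] in the domain [1, +oo[. *)
have r'0 : 0 < Num.min r (x - 1) by rewrite lt_min r0 subr_gt0.
exists (Num.min r (x - 1)) => //= h.
rewrite /ball_ /= sub0r normrN lt_min => /andP[hr hx] h0.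
have /= := rP (h + x).
rewrite addrK /GRing.scale /= mulr1 [_^-1 * _]mulrC; apply => //.
- by have := ler_norm (- h); rewrite normrN; lra.
- by rewrite -subr_eq0 addrK.
Qed.

Lemma is_derive_ge1_continuous g a b l : 1 <= a ->
  (forall x, 1 <= x -> is_derive_ge1 g x (l x)) ->
  {within `[a, b], continuous g}.
Proof.
move=> a1 gd; apply/subspace_continuousP => x /= /[!in_itv] /= /andP[ax xb].
have /is_derive_ge1P gx := gd x (le_trans a1 ax).
apply/cvgrPdist_lt => e e0.
have [r r0 rP] := gx 1 ltr01.
(* Within distance [r] of [x] the difference quotient is bounded by [M] in absolute value, so the
   radius [e / M] controls [g z - g x]. *)
pose M := `|l x| + 1.
have M0 : 0 < M by rewrite /M ltr_wpDl.
have r'0 : 0 < Num.min r (e / M) by rewrite lt_min r0 divr_gt0.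
exists (Num.min r (e / M)) => //= z; rewrite /ball_ /= distrC lt_min => /andP[zr ze].
rewrite in_itv /= => /andP[az _].
have [-> | zx] := eqVneq z x; first by rewrite subrr normr0.
have {}rP := rP z (le_trans a1 az) zr zx.
have zx0 : 0 < `|z - x| by rewrite normr_gt0 subr_eq0.
rewrite distrC -(@divfK _ (z - x) _ (g z - g x)) ?subr_eq0// normrM.
rewrite ltr_pdivlMr// in ze.
rewrite mulrC; apply: le_lt_trans ze; rewrite ler_wpM2l//.
rewrite -[X in `|X|](subrK (l x)) addrC; apply: le_trans (ler_normD _ _) _.
by rewrite lerD2l distrC ltW.
Qed.

(** Differentiability matters only inside ]a, b[, where 1 < x and the restricted derivative is the
    ordinary one; at the endpoints, 1 possibly among them, continuity suffices. *)
Lemma mvt_ge1 g l a b : (forall x, 1 <= x -> is_derive_ge1 g x (l x)) ->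
  1 <= a -> a <= b -> exists c, [/\ a <= c, c <= b & g b - g a = l c * (b - a)].
Proof.
move=> gd a1 ab.
have [x||c /[!in_itv] /= /andP[ac cb] ->] := @MVT_segment R g l a b ab.
- rewrite in_itv /= => /andP[ax _].
  by apply: is_derive_ge1_is_derive; [lra|apply: gd; lra].
- exact: is_derive_ge1_continuous gd.
- by exists c.
Qed.

Lemma nondecreasing_ge1 g l : (forall x, 1 <= x -> is_derive_ge1 g x (l x)) ->
  (forall x, 1 <= x -> 0 <= l x) ->
  forall x y, 1 <= x -> x <= y -> g x <= g y.
Proof.
move=> gd l0 x y x1 xy; have [c [xc cy E]] := mvt_ge1 gd x1 xy.
by rewrite -subr_ge0 E mulr_ge0 ?subr_ge0// l0// (le_trans x1).
Qed.

Lemma convex_increment_ge1 g l l' :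
  (forall x, 1 <= x -> is_derive_ge1 g x (l x)) ->
  (forall x, 1 <= x -> is_derive_ge1 l x (l' x)) ->
  (forall x, 1 <= x -> 0 <= l' x) ->
  forall s t q, 1 <= s -> s <= t -> 0 <= q ->
  g (s + q) - g s <= g (t + q) - g t.
Proof.
move=> gd ld l'0 s t q s1 st q0.
have lmon := nondecreasing_ge1 ld l'0.
(* The mean value points are ordered as soon as the two intervals do not overlap. If [s, s + q] and
   [t, t + q] do, the inequality is rearranged to compare the increments over [s, t] and
   [s + q, t + q] instead. *)
have [sqt|tsq] := leP (s + q) t.
  have [||c [c1 c2 ->]] := mvt_ge1 gd (_ : 1 <= s) (_ : s <= s + q); [lra|lra|].
  have [||d [d1 d2 ->]] := mvt_ge1 gd (_ : 1 <= t) (_ : t <= t + q); [lra|lra|].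
  by rewrite !(addrC _ q) !addrK ler_wpM2r// lmon; lra.
suff : g t - g s <= g (t + q) - g (s + q) by lra.
have [||c [c1 c2 ->]] := mvt_ge1 gd (_ : 1 <= s) (_ : s <= t); [lra|lra|].
have [||d [d1 d2 ->]] := mvt_ge1 gd (_ : 1 <= s + q) (_ : s + q <= t + q); [lra|lra|].
have -> : t + q - (s + q) = t - s by lra.
by rewrite ler_wpM2r ?subr_ge0// lmon; lra.
Qed.

End DeriveGe1.

(** * Rayleigh quotients *)

Section Rayleigh.
Local Open Scope classical_set_scope.
Variable R : realType.

Lemma continuous_sum_fct (T : topologicalType) (I : Type) (r : seq I)
    (F : I -> T -> R) :
  (forall i, continuous (F i)) -> continuous (fun t => \sum_(i <- r) F i t).
Proof.
move=> cF; elim: r => [|i r IH].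
  rewrite (_ : (fun _ => _) = fun=> 0); first by move=> x; exact: cvg_cst.
  by apply/funext => x; rewrite big_nil.
rewrite (_ : (fun _ => _) = fun x => F i x + \sum_(j <- r) F j x).
  by move=> x; apply: cvgD; [exact: cF|exact: IH].
by apply/funext => x; rewrite big_cons.
Qed.

Lemma continuous_mul_fct (T : topologicalType) (f g : T -> R) :
  continuous f -> continuous g -> continuous (fun t => f t * g t).
Proof. by move=> cf cg x; apply: cvgM; [exact: cf|exact: cg]. Qed.

Definition qform (T : finType) (a : T -> T -> R) (x : T -> R) : R :=
  \sum_u \sum_v a u v * x u * x v.

Definition sqnorm (T : finType) (x : T -> R) : R := \sum_u x u ^+ 2.

Lemma sqnorm_ge0 (T : finType) (x : T -> R) : 0 <= sqnorm x.
Proof. by apply: sumr_ge0 => u _; exact: sqr_ge0. Qed.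

Lemma sqnorm_eq0 (T : finType) (x : T -> R) : sqnorm x = 0 -> forall u, x u = 0.
Proof.
move=> /eqP; rewrite psumr_eq0 => [/allP x0 u|u _]; last exact: sqr_ge0.
by apply/eqP; have := x0 u (mem_index_enum u); rewrite /= sqrf_eq0.
Qed.

Lemma qformE (T : finType) (a : T -> T -> R) x :
  qform a x = \sum_u x u * \sum_v a u v * x v.
Proof.
by apply: eq_bigr => u _; rewrite mulr_sumr; apply: eq_bigr => v _; ring.
Qed.

Lemma sqnormZ (T : finType) c (x : T -> R) :
  sqnorm (fun u => c * x u) = c ^+ 2 * sqnorm x.
Proof. by rewrite /sqnorm mulr_sumr; apply: eq_bigr => u _; rewrite exprMn. Qed.

Lemma qformZ (T : finType) (a : T -> T -> R) c x :
  qform a (fun u => c * x u) = c ^+ 2 * qform a x.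
Proof.
rewrite /qform mulr_sumr; apply: eq_bigr => u _.
by rewrite mulr_sumr; apply: eq_bigr => v _; ring.
Qed.

(* A maximiser of a quadratic form is an eigenvector: perturb it by [t y]. *)
Lemma rayleigh_max_eigenvector (T : finType) (a : T -> T -> R) (M : R) x :
  (forall u v, a u v = a v u) ->
  (forall y, qform a y <= M * sqnorm y) -> qform a x = M * sqnorm x ->
  forall u, \sum_v a u v * x v = M * x u.
Proof.
move=> asym aM xM u.
pose r := M * x u - \sum_v a u v * x v.
suff r0 : r = 0 by apply/eqP; rewrite eq_sym -subr_eq0 -/r r0.
pose s := M - a u u.
have expand (t : R) : 0 <= 2 * t * r + t ^+ 2 * s.
  pose d v : R := (v == u)%:R.
  have dE (F : T -> R) : \sum_v d v * F v = F u.
    rewrite (bigD1 u)//= /d eqxx mul1r big1 ?addr0// => v /negPf ->.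
    by rewrite mul0r.
  have := aM (fun v => x v + t * d v).
  have -> : sqnorm (fun v => x v + t * d v) = sqnorm x + 2 * t * x u + t ^+ 2.
    rewrite /sqnorm -(dE (fun v => 2 * t * x v)) -[X in _ + X](dE (fun=> t ^+ 2)).
    rewrite -!big_split /=; apply: eq_bigr => v _.
    by rewrite /d; case: eqP => _ /=; ring.
  have -> : qform a (fun v => x v + t * d v)
      = qform a x + 2 * t * (\sum_v a u v * x v) + t ^+ 2 * a u u.
    have E1 : \sum_v \sum_w a v w * d v * x w = \sum_w a u w * x w.
      rewrite -[RHS](dE (fun v => \sum_w a v w * x w)); apply: eq_bigr => v _.
      by rewrite mulr_sumr; apply: eq_bigr => w _; ring.
    have E2 : \sum_v \sum_w a v w * x v * d w = \sum_w a u w * x w.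
      rewrite -E1 exchange_big /=; apply: eq_bigr => v _; apply: eq_bigr => w _.
      by rewrite asym; ring.
    have E3 : \sum_v \sum_w a v w * d v * d w = a u u.
      rewrite -[RHS](dE (fun v => a v u)); apply: eq_bigr => v _.
      rewrite -(dE (fun w => a v w)) mulr_sumr.
      by apply: eq_bigr => w _; ring.
    rewrite /qform (_ : 2 * t * _ = t * (\sum_w a u w * x w) + t * (\sum_w a u w * x w));
      last by ring.
    rewrite -{1}E1 -E2 -E3 !mulr_sumr -!big_split /=; apply: eq_bigr => v _.
    rewrite !mulr_sumr -!big_split /=; apply: eq_bigr => w _; ring.
  by rewrite xM /r /s; lra.
(* At this [t] one has r = -t(1 + |s|), so the expansion equals t^2 (s - 2 - 2|s|), which is at most
   -2t^2. Nonnegativity then forces t = 0, hence r = 0. *)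
have := expand (- r / (1 + `|s|)).
have s0 : 0 < 1 + `|s| by rewrite ltr_pwDl.
set t := - r / _ => h.
have tE : r = - (t * (1 + `|s|)) by rewrite /t divfK ?opprK// gt_eqF.
have {}h : 0 <= t ^+ 2 * (s - 2 - 2 * `|s|) by move: h; rewrite tE; lra.
have ss := ler_norm s; have sn := normr_ge0 s.
have : t ^+ 2 <= 0.
  have k0 : 0 <= - 2 - (s - 2 - 2 * `|s|) by lra.
  by have := mulr_ge0 (sqr_ge0 t) k0; lra.
rewrite exprn_even_le0//= => /eqP t0.
by rewrite tE t0 mul0r oppr0.
Qed.

(** The continuous form attains its maximum on the compact unit sphere, and homogeneity of degree 2
    extends the bound to all vectors. *)
Lemma exists_rayleigh_max (m : nat) (a : 'I_m -> 'I_m -> R) : (0 < m)%N ->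
  exists (M : R) (x : 'I_m -> R), [/\ sqnorm x = 1,
    qform a x = M & forall y, qform a y <= M * sqnorm y].
Proof.
move=> m0.
pose q (v : 'rV[R]_m) := qform a (fun i => v ord0 i).
pose n (v : 'rV[R]_m) := sqnorm (fun i => v ord0 i).
have coordc i : continuous (fun v : 'rV[R]_m => v ord0 i).
  exact: coord_continuous.
have nc : continuous n.
  apply: continuous_sum_fct => i.
  rewrite (_ : (fun _ => _) = fun w : 'rV[R]_m => w ord0 i * w ord0 i).
    exact: continuous_mul_fct.
  by apply/funext => w; rewrite expr2.
have qc : continuous q.
  apply: continuous_sum_fct => i; apply: continuous_sum_fct => j.
  apply: continuous_mul_fct => //; apply: continuous_mul_fct => //.
  exact: cst_continuous.
pose S := [set v | n v = 1].
have S0 : S !=set0.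
  exists (delta_mx ord0 (Ordinal m0)); rewrite /S /= /n /sqnorm.
  rewrite (bigD1 (Ordinal m0))//= mxE !eqxx expr1n big1 ?addr0// => i /negPf i0.
  by rewrite mxE i0 andbF expr0n.
have Sc : compact S.
  apply: bounded_closed_compact; last first.
    rewrite (_ : S = n @^-1` [set 1])//.
    by apply: closed_comp => // v _; exact: nc.
  exists 1; split=> // b b1 v Sv /=; apply: le_trans (ltW b1).
  rewrite [leLHS]/Num.norm /= mx_normrE; apply: bigmax_le => // -[i j] _ /=.
  rewrite ord1 -(ler_pXn2r (n := 2))// ?nnegrE// expr1n real_normK ?num_real//.
  rewrite -Sv /n /sqnorm (bigD1 j)//= lerDl.
  by apply: sumr_ge0 => k _; exact: sqr_ge0.
have [|c] := @EVT_max_rV R m q S S0 Sc.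
  by apply: continuous_subspaceT => v; exact: qc.
rewrite inE => Sc1 cM.
exists (q c), (fun i => c ord0 i); split=> // y.
have [y0|yn0] := eqVneq (sqnorm y) 0.
  rewrite y0 mulr0 /qform big1// => i _; rewrite big1// => j _.
  by rewrite !(sqnorm_eq0 y0) mulr0.
have yp : 0 < sqnorm y by rewrite lt_def yn0 sqnorm_ge0.
pose k := (Num.sqrt (sqnorm y))^-1.
have k2 : k ^+ 2 = (sqnorm y)^-1 by rewrite exprVn sqr_sqrtr ?sqnorm_ge0.
pose w := \row_i (k * y i).
have wE : (fun i => w ord0 i) = (fun i => k * y i) by apply/funext => i; rewrite mxE.
have := cM w; rewrite inE /S /= /n /q wE sqnormZ k2 mulVf// => /(_ erefl).
by rewrite qformZ k2 mulrC ler_pdivrMr.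
Qed.

Import ComplexField.Normc.

Lemma normc_sum_le (I : Type) (r : seq I) (F : I -> R[i]) :
  normc (\sum_(i <- r) F i) <= \sum_(i <- r) normc (F i).
Proof.
elim: r => [|i r IH]; first by rewrite !big_nil normc0.
by rewrite !big_cons; apply: le_trans (le_normcD _ _) _; rewrite lerD2l.
Qed.

Lemma normc_real (x : R) : normc x%:C%C = `|x|.
Proof. by rewrite /= expr0n addr0 sqrtr_sqr. Qed.

(* Entrywise absolute values turn a maximiser of the Rayleigh quotient into a
   nonnegative one. *)
Lemma spectral_radius_rayleigh (m : nat) (A : 'M[R]_m) : (0 < m)%N ->
  (forall i j, A i j = A j i) -> (forall i j, 0 <= A i j) ->
  (forall y, qform A y <= spectral_radius A * sqnorm y) /\
  exists x, [/\ forall i, 0 <= x i, sqnorm x = 1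
    & forall i, \sum_j A i j * x j = spectral_radius A * x i].
Proof.
move=> m0 Asym A0; have [M [x [x1 xM AM]]] := exists_rayleigh_max A m0.
pose y i : R := `|x i|.
have y0 i : 0 <= y i by exact: normr_ge0.
have y1 : sqnorm y = 1.
  by rewrite -x1; apply: eq_bigr => i _; rewrite real_normK ?num_real.
have yM : qform A y = M.
  apply/eqP; rewrite eq_le -{1}[M]mulr1 -{1}y1 AM /= -xM.
  apply: ler_sum => i _; apply: ler_sum => j _.
  rewrite -[X in _ <= X * _ * _](ger0_norm (A0 i j)) -!normrM.
  exact: ler_norm.
have yev : forall i, \sum_j A i j * y j = M * y i.
  by apply: rayleigh_max_eigenvector => //; rewrite y1 mulr1.
have M0 : 0 <= M.
  rewrite -yM; apply: sumr_ge0 => i _; apply: sumr_ge0 => j _.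
  by rewrite !mulr_ge0 ?A0 ?y0.
suff rhoE : spectral_radius A = M by rewrite rhoE; split=> //; exists y; split.
pose AC := map_mx (real_complex R) A.
have MC : eigenvalue AC M%:C%C.
  rewrite eigenvalue_map; apply/eigenvalueP; exists (\row_i y i).
    apply/rowP => i; rewrite !mxE -yev; apply: eq_bigr => j _.
    by rewrite mxE mulrC Asym.
  apply/eqP => /rowP yz.
  have : sqnorm y = 0.
    by apply: big1 => i _; have := yz i; rewrite !mxE => ->; rewrite expr0n.
  by rewrite y1 => /eqP; rewrite oner_eq0.
(* If [v] is a complex eigenvector for [z], the moduli w_i = |v_i| satisfy |z| w_i <= sum_j A_ij
   w_j. Multiplying by w_i and summing gives |z| |w|^2 <= q(w) <= M |w|^2, where q is the form of
   [A]. *)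
have ubM : ubound [set normc z | z in [set z : R[i] | eigenvalue AC z]] M.
  move=> _ [z /= /eigenvalueP[v vz vn0] <-].
  pose w i := normc (v ord0 i).
  have w0 i : 0 <= w i by rewrite /w; case: (v ord0 i) => ? ? /=; exact: sqrtr_ge0.
  have wn0 : 0 < sqnorm w.
    rewrite lt_def sqnorm_ge0 andbT; apply: contraNN vn0 => /eqP /sqnorm_eq0 w_0.
    by apply/eqP/rowP => i; rewrite mxE; apply: eq0_normc; exact: w_0.
  rewrite -(ler_pM2r wn0); apply: le_trans (AM w).
  rewrite qformE /sqnorm mulr_sumr; apply: ler_sum => i _.
  rewrite expr2 mulrCA; apply: ler_wpM2l => //.
  rewrite -normcM; have /rowP/(_ i) := vz; rewrite !mxE => <-.
  apply: le_trans (normc_sum_le _ _) _; apply: ler_sum => j _.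
  by rewrite normcM mxE normc_real ger0_norm// mulrC Asym.
apply/eqP; rewrite eq_le; apply/andP; split.
  by apply: ge_sup => //; exists (normc M%:C%C), M%:C%C.
apply: ub_le_sup; first by exists M.
by exists M%:C%C => //; rewrite normc_real ger0_norm.
Qed.

End Rayleigh.

(** * Comparison of weighted spectral radii *)

Section WeightedGraphs.
Variables (R : realType) (f : R -> R -> R).
Hypotheses (f_sym : symmetric_ge1 f) (f_Pstar : property_Pstar f).

Let f_gt0 x y : 1 <= x -> 1 <= y -> 0 < f x y.
Proof. by case: f_Pstar => + _ _; exact. Qed.

Lemma Pstar_mono x x' y y' : 1 <= x -> x <= x' -> 1 <= y -> y <= y' ->
  f x y <= f x' y'.
Proof.
case: f_Pstar => _ [fx [fxx fd]] _.
have mono u v w : 1 <= w -> 1 <= u -> u <= v -> f u w <= f v w.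
  move=> w1; apply: (@nondecreasing_ge1 R (f^~ w) (fx^~ w)) => t t1.
    by case: (fd t w t1 w1).
  by case: (fd t w t1 w1).
move=> x1 xx' y1 yy'; apply: (@le_trans _ _ (f x' y)); first exact: mono.
have x'1 := le_trans x1 xx'; have y'1 := le_trans y1 yy'.
by rewrite f_sym// [leRHS]f_sym//; exact: mono.
Qed.

Lemma Pstar_increment s t q y : 1 <= s -> s <= t -> 0 <= q -> 1 <= y ->
  f (s + q) y - f s y <= f (t + q) y - f t y.
Proof.
case: f_Pstar => _ [fx [fxx fd]] _ s1 st q0 y1.
by apply: (@convex_increment_ge1 R (f^~ y) (fx^~ y) (fxx^~ y)) => // u u1;
  case: (fd u y u1 y1).
Qed.

Lemma Pstar_spread x1 y1 x2 y2 : 1 <= x1 -> 1 <= y1 -> 1 <= x2 -> 1 <= y2 ->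
  x1 + y1 = x2 + y2 -> `|x2 - y2| < `|x1 - y1| -> f x2 y2 <= f x1 y1.
Proof. by case: f_Pstar => _ _; exact. Qed.

Definition weight (G : sgraph) (u v : G) : R :=
  if edge u v then f (degree u)%:R (degree v)%:R else 0.

Lemma degree_ge1 (G : sgraph) (u v : G) : edge u v -> 1 <= (degree u)%:R :> R.
Proof. by move=> uv; rewrite ler1n; apply/card_gt0P; exists v. Qed.

Lemma degree_ge1r (G : sgraph) (u v : G) : edge u v -> 1 <= (degree v)%:R :> R.
Proof. by rewrite edge_sym; exact: degree_ge1. Qed.

(** This is how the equality cases turn equal weights back into equal adjacency. *)
Lemma weight_gt0 (G : sgraph) (u v : G) : (0 < weight u v) = edge u v.
Proof.
rewrite /weight; case: ifPn => [uv|_]; last by rewrite ltxx.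
by rewrite f_gt0 ?(degree_ge1 uv) ?(degree_ge1r uv).
Qed.

Lemma weight_ge0 (G : sgraph) (u v : G) : 0 <= weight u v.
Proof.
have [uv|] := boolP (edge u v); first by rewrite ltW ?weight_gt0.
by rewrite /weight => /negPf ->.
Qed.

Lemma weight_sym (G : sgraph) (u v : G) : weight u v = weight v u.
Proof.
rewrite /weight edge_sym; case: ifPn => // vu.
by rewrite f_sym ?(degree_ge1 vu) ?(degree_ge1r vu).
Qed.

Notation rho := (weighted_spectral_radius f).

Lemma rho_rayleigh (G : sgraph) : (0 < #|G|)%N ->
  (forall y, qform (@weight G) y <= rho G * sqnorm y) /\
  exists x : G -> R, [/\ forall u, 0 <= x u, sqnorm x = 1
    & forall u, \sum_v weight u v * x v = rho G * x u].
Proof.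
move=> G0; pose A := weighted_adjacency f G.
have AE i j : A i j = weight (enum_val i) (enum_val j) by rewrite mxE.
have sumE (F : 'I_#|G| -> R) : \sum_i F i = \sum_(u : G) F (enum_rank u).
  exact: (reindex _ (onW_bij _ (@enum_rank_bij G))).
have [||Ale [x [x0 x1 xev]]] := @spectral_radius_rayleigh R _ A G0.
- by move=> i j; rewrite !AE weight_sym.
- by move=> i j; rewrite AE weight_ge0.
split=> [y|].
  have := Ale (y \o enum_val); congr (_ <= _ * _).
    rewrite /qform sumE; apply: eq_bigr => u _; rewrite sumE.
    by apply: eq_bigr => v _; rewrite AE /= !enum_rankK.
  by rewrite /sqnorm sumE; apply: eq_bigr => u _; rewrite /= enum_rankK.
exists (x \o enum_rank); split=> [u||u]; first exact: x0.
  by rewrite -x1 /sqnorm sumE.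
rewrite -xev sumE; apply: eq_bigr => v _.
by rewrite AE !enum_rankK.
Qed.

(** If [x] vanishes at a vertex, the eigenvalue equation there is a vanishing sum of nonnegative
    terms, so [x] vanishes at all neighbours; by connectedness it would vanish everywhere. *)
Lemma perron_vector_gt0 (G : sgraph) (x : G -> R) c : connected_graph G ->
  (forall u, 0 <= x u) -> sqnorm x = 1 ->
  (forall u, \sum_v weight u v * x v = c * x u) -> forall u, 0 < x u.
Proof.
move=> /andP[_ /forallP Gc] x0 x1 xev u; rewrite lt_def x0 andbT.
apply/negP => /eqP xu.
have cl : fingraph.closed (@edge G) [pred v | x v == 0].
  apply: intro_closed => [|v w vw]; first exact/sym_connect_sym/edge_sym.
  rewrite !inE => /eqP xv; have := xev v; rewrite xv mulr0 => /eqP.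
  rewrite psumr_eq0 => [/allP/(_ w (mem_index_enum w)) /=|z _]; last first.
    by rewrite mulr_ge0// weight_ge0.
  by rewrite mulf_eq0 gt_eqF// weight_gt0.
have : sqnorm x = 0.
  apply: big1 => v _; have := closed_connect cl (forallP (Gc u) v).
  by rewrite !inE xu eqxx => /esym/eqP ->; rewrite expr0n.
by rewrite x1 => /eqP; rewrite oner_eq0.
Qed.

(** The vector [x], carried to [H] along [h], is a test vector for the Rayleigh quotient of [H]. If
    the radii agree, it is a maximiser there too, hence an eigenvector of both matrices for the same
    eigenvalue. *)
Lemma rho_compare (G H : sgraph) (h : G -> H) (x : G -> R) :
  bijective h -> sqnorm x = 1 ->
  (forall u, \sum_v weight u v * x v = rho G * x u) ->
  qform (@weight G) x <= qform (fun u v => weight (h u) (h v)) x ->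
  rho G <= rho H /\ (rho G = rho H -> forall u,
    \sum_v weight (h u) (h v) * x v = \sum_v weight u v * x v).
Proof.
move=> hbij x1 xev qle.
have [u0|G0] := pickP G; last first.
  move: x1; rewrite /sqnorm big1 ?(eqP (oner_neq0 _)) => [/eqP|u _].
    by rewrite eq_sym oner_eq0.
  by have := G0 u.
have H0 : (0 < #|H|)%N by apply/card_gt0P; exists (h u0).
have [Hle _] := rho_rayleigh H0.
have qG : qform (@weight G) x = rho G.
  rewrite qformE -[RHS]mulr1 -x1 /sqnorm mulr_sumr; apply: eq_bigr => u _.
  by rewrite xev; ring.
have Hx (y : G -> R) : qform (fun u v => weight (h u) (h v)) y <= rho H * sqnorm y.
  case: (hbij) => g hK gK.
  have sumE (F : H -> R) : \sum_i F i = \sum_(u : G) F (h u).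
    exact: (reindex _ (onW_bij _ hbij)).
  have := Hle (y \o g); congr (_ <= _ * _).
    rewrite /qform sumE; apply: eq_bigr => u _; rewrite sumE.
    by apply: eq_bigr => v _; rewrite /= !hK.
  by rewrite /sqnorm sumE; apply: eq_bigr => u _; rewrite /= hK.
have HxG := Hx x; rewrite x1 mulr1 in HxG.
split=> [|GH u]; first by rewrite -qG (le_trans qle).
rewrite xev GH.
apply: (@rayleigh_max_eigenvector R G (fun u v => weight (h u) (h v))) => //.
  by move=> v w; exact: weight_sym.
by rewrite x1 mulr1; apply/eqP; rewrite eq_le HxG -GH -qG.
Qed.

Definition dominated (G H : sgraph) : Prop :=
  rho G <= rho H /\ (connected_graph G -> rho G = rho H -> graph_iso G H).

Lemma graph_iso_trans (G H K : sgraph) :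
  graph_iso G H -> graph_iso H K -> graph_iso G K.
Proof.
move=> [g gb gm] [h hb hm]; exists (h \o g); first exact: bij_comp.
by move=> x y /=; rewrite hm gm.
Qed.

Lemma graph_iso_sym (G H : sgraph) : graph_iso G H -> graph_iso H G.
Proof.
move=> [g [h gK hK] gm]; exists h; first by exists g.
by move=> x y; rewrite -gm !hK.
Qed.

Lemma graph_iso_connected (G H : sgraph) :
  graph_iso G H -> connected_graph G -> connected_graph H.
Proof.
move=> [g gb gm] /andP[G0 /forallP Gc].
have [h gK hK] := gb.
apply/andP; split; first by rewrite -(bij_eq_card gb).
apply/forallP => x; apply/forallP => y.
have /connectP[p pp yE] := forallP (Gc (h x)) (h y).
apply/connectP; exists (map g p).
  by rewrite -(hK x) path_map (eq_path (e' := @edge G)).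
by rewrite -(hK x) last_map -yE hK.
Qed.

(** In the equality case [H] is connected because it is already known to be isomorphic to [G]. *)
Lemma dominated_trans (G H K : sgraph) :
  dominated G H -> dominated H K -> dominated G K.
Proof.
move=> [GH GHe] [HK HKe]; split=> [|Gc GK]; first exact: le_trans GH HK.
have eGH : rho G = rho H by apply/eqP; rewrite eq_le GH /= GK HK.
have iGH := GHe Gc eGH.
apply: (graph_iso_trans iGH); apply: HKe; last by rewrite -eGH.
exact: graph_iso_connected iGH Gc.
Qed.

(** Degrees do not drop along [h], so monotonicity of [f] raises every weight. In the equality case
    the row sums against a positive vector agree, so they agree term by term and [h] reflects
    edges. *)
Lemma hom_dominated (G H : sgraph) (h : G -> H) : (0 < #|G|)%N -> bijective h ->
  {homo h : u v / edge u v} -> dominated G H.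
Proof.
move=> G0 hb hm; have [_ [x [x0 x1 xev]]] := rho_rayleigh G0.
have deg_le u : (degree u <= degree (h u))%N.
  rewrite /degree -(fintype.card_image (bij_inj hb) [pred v | edge u v]).
  apply: subset_leq_card.
  by apply/fintype.subsetP => _ /fintype.imageP[v uv ->]; exact: hm.
have wle u v : weight u v <= weight (h u) (h v).
  rewrite {1}/weight; case: ifPn => [uv|_]; last exact: weight_ge0.
  rewrite /weight hm// Pstar_mono ?ler_nat//.
    exact: degree_ge1 uv.
  exact: degree_ge1r uv.
have [|le eq] := rho_compare hb x1 xev.
  apply: ler_sum => u _; apply: ler_sum => v _.
  by rewrite !ler_wpM2r.
split=> // Gc /eq E; exists h => // u v.
have xp := perron_vector_gt0 Gc x0 x1 xev.
apply/idP/idP => [|/hm//]; rewrite -!weight_gt0.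
suff -> : weight u v = weight (h u) (h v) by [].
have /eqP := E u; rewrite eq_sym -subr_eq0 -opprB oppr_eq0 -sumrB.
rewrite psumr_eq0 => [/allP/(_ v (mem_index_enum v)) /=|w _]; last first.
  by rewrite -mulrBl mulr_ge0// subr_ge0.
by rewrite -mulrBl mulf_eq0 (gt_eqF (xp v)) orbF subr_eq0 => /eqP.
Qed.

End WeightedGraphs.

(** * Kelmans' operation *)

Section Kelmans.
Variables (G : sgraph) (u v : G).

Definition kelmans_moved : pred G := fun y => [&& edge v y, ~~ edge u y & y != u].

Definition kelmans_rel : rel G := fun x y =>
  if x == u then edge u y || kelmans_moved y
  else if x == v then edge v y && ~~ kelmans_moved y
  else if y == u then edge u x || kelmans_moved x
  else if y == v then edge v x && ~~ kelmans_moved x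
  else edge x y.

Fact kelmans_sym : symmetric kelmans_rel.
Proof.
move=> x y; rewrite /kelmans_rel /kelmans_moved.
have [->|xu] := eqVneq x u; have [->|yu] := eqVneq y u => //.
  have [->|yv] := eqVneq y v; last by [].
  by rewrite !edge_irr ?eqxx (edge_sym u v); case: (edge v u).
  have [->|xv] := eqVneq x v; last by [].
  by rewrite !edge_irr ?eqxx (edge_sym u v); case: (edge v u).
have [xv|_] := eqVneq x v; have [yv|_] := eqVneq y v; rewrite ?xv ?yv //.
exact: edge_sym.
Qed.

Fact kelmans_irr : irreflexive kelmans_rel.
Proof.
move=> x; rewrite /kelmans_rel /kelmans_moved.
have [->|xu] := eqVneq x u; first by rewrite edge_irr !andbF.
by have [->|xv] := eqVneq x v; rewrite edge_irr.
Qed.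

(* Kelmans' operation: every edge from [v] to a vertex which is neither [u] nor
   adjacent to [u] is moved to [u]. *)
Definition kelmans : sgraph := SGraph kelmans_sym kelmans_irr.

Lemma degreeE (H : sgraph) (x : H) : degree x = (\sum_y (edge x y : nat))%N.
Proof.
by rewrite /degree -sum1_card big_mkcond; apply: eq_bigr => y _; rewrite inE; case: edge.
Qed.

Definition kelmans_shift := #|kelmans_moved|.

Lemma kelmans_shiftE : kelmans_shift = (\sum_y (kelmans_moved y : nat))%N.
Proof.
rewrite /kelmans_shift -sum1_card big_mkcond; apply: eq_bigr => y _.
by rewrite unfold_in /kelmans_moved; case: ifP.
Qed.

Lemma degree_kelmans_gain : degree (u : kelmans) = (degree u + kelmans_shift)%N.
Proof.
rewrite !degreeE kelmans_shiftE -big_split; apply: eq_bigr => y _.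
rewrite /= /kelmans_rel eqxx /kelmans_moved.
by case: (edge u y) => /=; rewrite ?andbF ?addn0.
Qed.

Hypothesis uv : u != v.

Lemma degree_kelmans_lose : (degree (v : kelmans) + kelmans_shift)%N = degree v.
Proof.
rewrite !degreeE kelmans_shiftE -big_split; apply: eq_bigr => y _.
rewrite /= /kelmans_rel [v == u]eq_sym (negPf uv) eqxx /kelmans_moved.
by case: (edge v y); case: (edge u y); case: (y == u).
Qed.

(** Such a [w] at most trades its edge to [v] for an edge to [u]. *)
Lemma degree_kelmans_other (w : G) : w != u -> w != v ->
  degree (w : kelmans) = degree w.
Proof.
move=> wu wv; rewrite !degreeE (bigD1 u)// (bigD1 v) 1?eq_sym//=.
rewrite [RHS](bigD1 u)// [in RHS](bigD1 v) 1?eq_sym//= !addnA.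
congr addn; last first.
  apply: eq_bigr => y /andP[yu yv].
  by rewrite /kelmans_rel (negPf wu) (negPf wv) (negPf yu) (negPf yv).
rewrite /kelmans_rel (negPf wu) (negPf wv) eqxx [v == u]eq_sym (negPf uv) eqxx.
rewrite /kelmans_moved wu andbT [edge w u]edge_sym [edge w v]edge_sym.
by case: (edge u w); case: (edge v w).
Qed.

(** Apart from [u], the vertex [v] keeps only neighbours that it shares with [u]; a possible edge
    between [u] and [v] counts once on each side. *)
Lemma degree_kelmans_lose_le : (degree (v : kelmans) <= degree u)%N.
Proof.
rewrite /degree (cardD1 u) [leqRHS](cardD1 v); apply: leq_add.
  by rewrite !inE /= /kelmans_rel [v == u]eq_sym (negPf uv) eqxx
    /kelmans_moved edge_irr eqxx !andbF andbT [edge v u]edge_sym.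
apply: subset_leq_card; apply/fintype.subsetP => y; rewrite !inE /=.
rewrite /kelmans_rel [v == u]eq_sym (negPf uv) eqxx /kelmans_moved.
case/and3P => yu vy; rewrite vy yu andbT /= negbK => ->; rewrite andbT.
by apply: contraTneq vy => ->; rewrite edge_irr.
Qed.

End Kelmans.

(** Outside [u] and [v], one of them ends up with the union of the two neighbourhoods and the other
    with the intersection; the order of the arguments only decides which. *)
Lemma kelmans_swap (G : sgraph) (u v : G) : u != v ->
  {mono (tperm u v : kelmans u v -> kelmans v u) : x y / edge x y}.
Proof.
move=> uv x y /=.
rewrite /kelmans_rel /kelmans_moved.
have vu : (v == u) = false by rewrite eq_sym (negPf uv).
case: tpermP => [->|->|/eqP xu /eqP xv]; case: tpermP => [->|->|/eqP yu /eqP yv];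
  rewrite ?eqxx ?vu ?(negPf uv) ?(negPf xu) ?(negPf xv) ?(negPf yu) ?(negPf yv);
  rewrite ?edge_irr ?eqxx ?andbF ?andbT ?orbF ?(edge_sym v u) //=.
all: rewrite ?(negPf uv) ?vu ?eqxx ?andbT ?andbF ?orbF//=.
all: try by case: (edge u v).
all: try by case: (edge u y); case: (edge v y).
all: try by case: (edge u x); case: (edge v x).
Qed.

(** * Kelmans' operation does not decrease the weighted spectral radius *)

Section KelmansRadius.
Variables (R : realType) (f : R -> R -> R).
Hypotheses (f_sym : symmetric_ge1 f) (f_Pstar : property_Pstar f).

Notation rho := (weighted_spectral_radius f).
Notation wt := (weight f).

(** This treats the edge between [u] and [v]: [s] is the old degree of [u], [t] the new degree of
    [v], and [q] the number of moved edges. Condition (ii) needs a strict change of spread, so q = 0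
    and t = s are handled apart. *)
Lemma Pstar_transfer s t q : 1 <= t -> t <= s -> 0 <= q ->
  f s (t + q) <= f (s + q) t.
Proof.
move=> t1 ts; rewrite le_eqVlt => /predU1P[<-|q0]; first by rewrite !addr0.
move: ts; rewrite le_eqVlt => /predU1P[<-|ts].
  by rewrite f_sym//; lra.
apply: (Pstar_spread f_Pstar); try lra.
by rewrite [ltRHS]ger0_norm ?ltr_norml; [apply/andP; split|]; lra.
Qed.

(** Kelmans' operation changes only weights of pairs meeting {u, v}, which this expansion
    isolates. *)
Lemma qform_split2 (T : finType) (a : T -> T -> R) (x : T -> R) u v :
  u != v -> (forall w w', a w w' = a w' w) ->
  qform a x = a u u * x u ^+ 2 + a v v * x v ^+ 2 + 2 * (a u v * x u * x v)
    + 2 * (\sum_(w | (w != u) && (w != v)) (a u w * x u + a v w * x v) * x w)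
    + \sum_(w | (w != u) && (w != v)) \sum_(w' | (w' != u) && (w' != v))
        a w w' * x w * x w'.
Proof.
move=> uv asym; have vu : v != u by rewrite eq_sym.
have split2 (F : T -> R) :
    \sum_w F w = F u + F v + \sum_(w | (w != u) && (w != v)) F w.
  by rewrite (bigD1 u)//= (bigD1 v)//= addrA.
rewrite /qform split2 !(split2 (fun w' => a _ w' * _ * _)).
under [X in _ + X = _]eq_bigr do rewrite split2.
rewrite !big_split /= (asym v u).
have E w : \sum_(i | (i != u) && (i != v)) a i w * x i * x w
  = \sum_(i | (i != u) && (i != v)) a w i * x w * x i.
  by apply: eq_bigr => i _; rewrite asym; ring.
have S : \sum_(w | (w != u) && (w != v)) (a u w * x u + a v w * x v) * x w
  = \sum_(w | (w != u) && (w != v)) a u w * x u * x w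
  + \sum_(w | (w != u) && (w != v)) a v w * x v * x w.
  by rewrite -big_split; apply: eq_bigr => w _; rewrite mulrDl.
rewrite S !E; ring.
Qed.

Section Step.
Variables (G : sgraph) (u v : G).
Hypothesis uv : u != v.
Let K := kelmans u v.

Let vu : (v == u) = false. Proof. by rewrite eq_sym (negPf uv). Qed.

Let gainE : (degree (u : K))%:R = (degree u)%:R + (kelmans_shift u v)%:R :> R.
Proof. by rewrite degree_kelmans_gain natrD. Qed.

Let loseE : (degree v)%:R = (degree (v : K))%:R + (kelmans_shift u v)%:R :> R.
Proof. by rewrite -(degree_kelmans_lose uv) natrD. Qed.

Let lose_le : (degree (v : K))%:R <= (degree u)%:R :> R.
Proof. by rewrite ler_nat degree_kelmans_lose_le. Qed.

Lemma kelmans_weight_gain y : wt u y <= wt (u : K) (y : K).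
Proof.
rewrite {1}/weight; case: ifPn => [uy|_]; last exact: weight_ge0.
have uyK : edge (u : K) y by rewrite /= /kelmans_rel eqxx uy.
have u1 := degree_ge1 R uy; have y1 := degree_ge1r R uy.
have yK1 := degree_ge1r R uyK.
rewrite /weight uyK gainE.
have [yv|yv] := eqVneq y v.
  by rewrite yv in yK1 *; rewrite loseE Pstar_transfer.
have yu : y != u by apply: contraTneq uy => ->; rewrite edge_irr.
by rewrite (degree_kelmans_other uv)// Pstar_mono// lerDl.
Qed.

Lemma kelmans_weight_same w w' : w != u -> w != v -> w' != u -> w' != v ->
  wt (w : K) (w' : K) = wt w w'.
Proof.
move=> wu wv w'u w'v; rewrite /weight !(degree_kelmans_other uv)//=.
by rewrite /kelmans_rel (negPf wu) (negPf wv) (negPf w'u) (negPf w'v).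
Qed.

(** If [w] is a private neighbour of [v], its edge moves to [u], where both the degree and the
    coefficient are at least as large. If [w] is a common neighbour, convexity makes the gain at [u]
    at least the loss at [v], and the gain has the larger coefficient [a]. *)
Lemma kelmans_weight_pair w a b : w != u -> w != v -> 0 <= b -> b <= a ->
  wt u w * a + wt v w * b <= wt (u : K) (w : K) * a + wt (v : K) (w : K) * b.
Proof.
move=> wu wv b0 ba; have a0 := le_trans b0 ba.
have [vw|vw] := boolP (edge v w); last first.
  have -> : wt v w = 0 by rewrite /weight (negPf vw).
  rewrite mul0r addr0 -[leLHS]addr0 lerD ?ler_wpM2r ?kelmans_weight_gain//.
  by rewrite mulr_ge0// weight_ge0.
have w1 := degree_ge1r R vw; have v1 := degree_ge1 R vw.
rewrite /weight !(degree_kelmans_other uv wu wv) /= /kelmans_rel !eqxx vu.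
rewrite gainE /kelmans_moved vw wu andbT /= negbK orbN.
have [uw|uw] := boolP (edge u w); last first.
  rewrite mul0r add0r mul0r addr0; apply: ler_pM => //.
    by case: f_Pstar => f0 _ _; apply/ltW/f0.
  by apply: (Pstar_mono f_sym f_Pstar) => //; rewrite loseE lerD2r.
have vK1 : 1 <= (degree (v : K))%:R :> R.
  apply: (@degree_ge1 R K v w).
  by rewrite /= /kelmans_rel vu eqxx /kelmans_moved vw uw.
have := Pstar_increment f_Pstar vK1 lose_le (ler0n _ (kelmans_shift u v)) w1.
rewrite -loseE.
have : f (degree u)%:R (degree w)%:R
    <= f ((degree u)%:R + (kelmans_shift u v)%:R) (degree w)%:R.
  by rewrite Pstar_mono ?(degree_ge1 R uw) ?lerDl.
nra.
Qed.

Lemma kelmans_qform_le (x : G -> R) : (forall w, 0 <= x w) -> x v <= x u ->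
  qform (@weight R f G) x <= qform (fun w w' => wt (w : K) (w' : K)) x.
Proof.
move=> x0 xvu; rewrite !(qform_split2 x uv); try by move=> w w'; exact: weight_sym.
have w0 (H : sgraph) (y : H) : wt y y = 0 by rewrite /weight edge_irr.
rewrite !w0 !mul0r !add0r; apply: lerD; first apply: lerD.
- by rewrite ler_pM2l// !ler_wpM2r// kelmans_weight_gain.
- rewrite ler_pM2l//; apply: ler_sum => w /andP[wu wv].
  by rewrite ler_wpM2r// kelmans_weight_pair.
- apply: ler_sum => w /andP[wu wv]; apply: ler_sum => w' /andP[w'u w'v].
  by rewrite kelmans_weight_same.
Qed.

(** If the radii agree, the rows of [u] agree against a positive vector although no weight at [u]
    has dropped. Hence [u] gains no neighbour, nothing is moved, and the identity is an
    isomorphism. *)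
Lemma kelmans_dominated_oriented (x : G -> R) : (forall w, 0 <= x w) ->
  sqnorm x = 1 -> (forall w, \sum_y wt w y * x y = rho G * x w) ->
  x v <= x u -> dominated f G K.
Proof.
move=> x0 x1 xev xvu.
have [||le eq] := @rho_compare R f f_sym f_Pstar G K id x _ x1 xev.
- by exists id.
- exact: kelmans_qform_le.
split=> [|Gc GK]; first exact: le.
have E := eq GK u.
have xp := perron_vector_gt0 f_Pstar Gc x0 x1 xev.
exists id; first by exists id.
have same y : edge (u : K) y = edge u y.
  rewrite -!(weight_gt0 f_Pstar); congr (0 < _).
  move/eqP: E; rewrite -subr_eq0 -sumrB psumr_eq0.
    move=> /allP/(_ y (mem_index_enum y)) /=.
    by rewrite -mulrBl mulf_eq0 (gt_eqF (xp y)) orbF subr_eq0 => /eqP.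
  move=> w _; rewrite -mulrBl; apply: mulr_ge0; last exact: x0.
  by rewrite subr_ge0; exact: kelmans_weight_gain.
have nomove y : kelmans_moved u v y = false.
  have := same y; rewrite /= /kelmans_rel eqxx /kelmans_moved.
  by case: (edge u y) => /=; rewrite ?andbF.
move=> w y; rewrite /= /kelmans_rel !nomove !orbF !andbT.
have [->//|_] := eqVneq w u; have [->//|_] := eqVneq w v.
have [->|_] := eqVneq y u; first exact: edge_sym.
by have [->|//] := eqVneq y v; exact: edge_sym.
Qed.

End Step.

Lemma kelmans_dominated (G : sgraph) (u v : G) : u != v ->
  dominated f G (kelmans u v).
Proof.
move=> uv; have vu : v != u by rewrite eq_sym.
have G0 : (0 < #|G|)%N by apply/card_gt0P; exists u.
have [_ [x [x0 x1 xev]]] := rho_rayleigh f_sym f_Pstar G0.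
have [xvu|/ltW xuv] := leP (x v) (x u).
  exact: kelmans_dominated_oriented x0 x1 xev xvu.
apply: dominated_trans (kelmans_dominated_oriented vu x0 x1 xev xuv) _.
apply: (@hom_dominated R f f_sym f_Pstar (kelmans v u) (kelmans u v) (tperm v u)) => //.
  by exists (tperm v u); exact: tpermK.
by move=> w y; rewrite -(kelmans_swap vu).
Qed.

End KelmansRadius.

(** * Separations and the extremal graph *)

Section Extremal.
Variables (R : realType) (f : R -> R -> R).
Hypotheses (f_sym : symmetric_ge1 f) (f_Pstar : property_Pstar f).

Lemma independentP (G : sgraph) (S : {set G}) :
  reflect {in S &, forall x y, edge x y = false} (independent S).
Proof.
apply: (iffP forall_inP) => [Si x y xS yS | Si x xS].
  by apply/negbTE; have /forall_inP := Si x xS; apply.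
by apply/forall_inP => y yS; rewrite Si.
Qed.

Lemma exists_set_between (T : finType) (A B : {set T}) m :
  A \subset B -> (#|A| <= m <= #|B|)%N ->
  exists C : {set T}, [/\ A \subset C, C \subset B & #|C| = m].
Proof.
move=> AB /andP[Am mB]; pose s := take (m - #|A|) (enum (B :\: A)).
have sP x : x \in s -> (x \in B) && (x \notin A).
  by move=> /mem_take; rewrite mem_enum inE andbC.
exists (A :|: [set x in s]%SET); split; first exact: finset.subsetUl.
  rewrite finset.subUset AB; apply/fintype.subsetP => x.
  by rewrite inE => /sP /andP[].
have -> : #|A :|: [set x in s]%SET| = (#|A| + #|[set x in s]%SET|)%N.
  rewrite cardsU (_ : A :&: _ = finset.set0) ?cards0 ?subn0//.
  apply/setP => x; rewrite !inE; apply/negP => /andP[xA /sP].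
  by rewrite xA andbF.
rewrite cardsE (card_uniqP _) ?take_uniq ?enum_uniq// size_takel ?subnKC//.
by rewrite -cardE cardsDS// leq_sub2r.
Qed.

(** The complement of [T] becomes the [K_kappa], [a] the isolated [K_1], the rest of [T] outside [S]
    the inner clique, and [S] without [a] the edgeless part. The non-edges of the extremal graph,
    between [a] and [T] or inside [S], are then non-edges of [G]. *)
Lemma extremal_graph_embedding (G : sgraph) (kappa : nat) (S T : {set G}) a :
  independent S -> a \in S -> S \subset T -> (#|T| + kappa)%N = #|G| ->
  {in T, forall y, edge a y = false} ->
  exists2 h : G -> extremal_graph #|G| kappa #|S|,
    bijective h & {homo h : x y / edge x y}.
Proof.
move=> /independentP Si aS ST Tk aT.
pose E := extremal_graph #|G| kappa #|S|.
have cT : #|~: T| = kappa by have := cardsC T; lia.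
have cTS : #|T :\: S| = (#|G| - kappa - #|S|)%N by rewrite cardsDS//; lia.
have cS : #|S :\ a| = (#|S| - 1)%N by have := cardsD1 a S; rewrite aS; lia.
pose g (z : E) : G := match z with
  | inl i => nth a (enum (~: T)) i
  | inr (inl _) => a
  | inr (inr (inl i)) => nth a (enum (T :\: S)) i
  | inr (inr (inr i)) => nth a (enum (S :\ a)) i
  end.
have nthP (A : {set G}) m (i : 'I_m) : #|A| = m -> nth a (enum A) i \in A.
  by move=> Am; rewrite -mem_enum mem_nth// -cardE Am.
have nth_inj (A : {set G}) m (i j : 'I_m) : #|A| = m ->
    nth a (enum A) i = nth a (enum A) j -> i = j.
  move=> Am /eqP; rewrite nth_uniq ?enum_uniq -?cardE ?Am//.
  by move=> /eqP ij; exact: val_inj.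
have STi x : x \in S -> x \in T by move/fintype.subsetP: ST; apply.
have gP (z : E) : match z with
  | inl _ => g z \notin T
  | inr (inl _) => g z == a
  | inr (inr (inl _)) => (g z \in T) && (g z \notin S)
  | inr (inr (inr _)) => (g z \in S) && (g z != a)
  end.
  case: z => [i|[i|[i|i]]] //=.
  - by have := nthP _ _ i cT; rewrite inE.
  - by have := nthP _ _ i cTS; rewrite inE andbC.
  - by have := nthP _ _ i cS; rewrite !inE andbC.
have ginj : injective g.
  move=> y z gyz; have := gP y; have := gP z; rewrite gyz.
  have : (g z \in S) ==> (g z \in T) by apply/implyP; exact: STi.
  have : (g z == a) ==> (g z \in S) by apply/implyP => /eqP ->.
  move: (g z \in T) (g z \in S) (g z == a) => bT bS ba.
  case: y z gyz => [i|[i|[i|i]]] [j|[j|[j|j]]] gyz;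
    try by case: bT; case: bS; case: ba.
  - by move=> _ _; have -> : i = j by exact: nth_inj cT gyz.
  - by move=> _ _; rewrite (ord1 i) (ord1 j).
  - by move=> _ _; have -> : i = j by exact: nth_inj cTS gyz.
  - by move=> _ _; have -> : i = j by exact: nth_inj cS gyz.
have gbij : bijective g.
  apply: inj_card_bij => //.
  rewrite /E /extremal_graph /= !card_sum !card_ord; lia.
have [h hK gK] := gbij.
exists h; first by exists g.
clearbody g.
suff gE (y z : E) : edge (g y) (g z) -> edge y z.
  by move=> x y xy; apply: gE; rewrite !gK.
move=> e; have yz : y != z by apply: contraTneq e => ->; rewrite edge_irr.
have := gP y; have := gP z.
case: y z e yz => [i|[i|[i|i]]] [j|[j|[j|j]]] e yz //.
- by move=> /andP[jT _] /eqP gi; rewrite gi aT in e.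
- by move=> /andP[/STi jT _] /eqP gi; rewrite gi aT in e.
- by move=> /eqP gj /andP[iT _]; rewrite gj edge_sym aT in e.
- by move=> /eqP gj /andP[/STi iT _]; rewrite gj edge_sym aT in e.
- by move=> /andP[jS _] /andP[iS _]; rewrite Si in e.
Qed.

(** [U] may be too large: it is cut down to a set [T] of exactly |G| - kappa vertices that still
    contains [S]. *)
Lemma nonadjacent_dominated (G : sgraph) (kappa : nat) (S U : {set G}) a :
  independent S -> a \in S -> S \subset U -> {in U, forall y, edge a y = false} ->
  (#|S| + kappa <= #|G|)%N -> (#|G| <= #|U| + kappa)%N ->
  dominated f G (extremal_graph #|G| kappa #|S|).
Proof.
move=> Si aS SU aU Sk Uk.
have [|T [ST TU cT]] := @exists_set_between G S U (#|G| - kappa) SU.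
  by apply/andP; split; lia.
have [|y yT|h hb hm] := @extremal_graph_embedding G kappa S T a Si aS ST.
- by rewrite cT; lia.
- by apply: aU; move/fintype.subsetP: TU; apply.
apply: hom_dominated hb hm => //.
by apply/card_gt0P; exists a.
Qed.

Section Separation.
Variables (kappa : nat).

(* [A] and [B] are unions of components left after deleting [kappa] vertices. *)
Definition separation (G : sgraph) (A B : {set G}) : Prop :=
  [/\ [disjoint A & B], {in A & B, forall x y, edge x y = false},
      exists y, y \in B & (#|A| + #|B| + kappa)%N = #|G|].

Lemma separation_meet_dominated (G : sgraph) (A B S : {set G}) a :
  separation A B -> independent S -> a \in S -> a \in A ->
  (#|S| + kappa <= #|G|)%N ->
  dominated f G (extremal_graph #|G| kappa #|S|).
Proof.
move=> [dAB nAB [b bB] cAB] /independentP Si aS aA Sk.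
have ba : b != a by apply: contraTneq bB => ->; rewrite (disjointFr dAB).
apply: dominated_trans (kelmans_dominated f_sym f_Pstar ba) _.
have ab : (a == b) = false by rewrite eq_sym (negPf ba).
pose K := kelmans b a.
(* Neighbours of [a] in [A] are not adjacent to [b], so all of them move to [b]; in [B] and [S]
   there were none. *)
have aK (y : G) : y \in A :|: B :|: S -> edge (a : K) y = false.
  rewrite /= /kelmans_rel ab eqxx /kelmans_moved => yABS.
  have [ay|//] := boolP (edge a y); rewrite /=.
  have yA : y \in A.
    move: yABS; rewrite !inE => /orP[/orP[//|yB]|yS].
      by rewrite nAB in ay.
    by rewrite Si in ay.
  have -> : edge b y = false by rewrite edge_sym nAB.
  by rewrite (contraTneq _ yA) // => ->; rewrite (disjointFl dAB).
(* New edges occur only at [b] and lead to former neighbours of [a], which lie outside [S] because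
   [a] is in [S]. *)
have SiK : @independent K S.
  apply/independentP => x y xS yS; rewrite /= /kelmans_rel /kelmans_moved.
  have [xb|_] := eqVneq x b; first by rewrite xb in xS; rewrite !Si.
  have [_|_] := eqVneq x a; first by rewrite Si.
  have [yb|_] := eqVneq y b; first by rewrite yb in yS; rewrite !Si.
  by have [_|_] := eqVneq y a; rewrite Si.
apply: (@nonadjacent_dominated K kappa S (A :|: B :|: S) a) => //.
  exact: finset.subsetUr.
have : (#|A :|: B| <= #|A :|: B :|: S|)%N by rewrite subset_leq_card// finset.subsetUl.
rewrite cardsU disjoint_setI0// cards0 subn0 => ABU.
by rewrite -[#|K|]/(#|G|) -cAB leq_add2r.
Qed.

Lemma separation_dominated (G : sgraph) (A B S : {set G}) :
  separation A B -> (0 < #|A|)%N -> independent S -> (0 < #|S|)%N ->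
  (#|S| + kappa <= #|G|)%N ->
  dominated f G (extremal_graph #|G| kappa #|S|).
Proof.
move=> sep /card_gt0P[a aA] Si /card_gt0P[w wS] Sk.
have [dAB nAB [b bB] cAB] := sep.
have [SA|[c]] := set_0Vmem (S :&: A); last first.
  by rewrite inE => /andP[cS cA]; exact: separation_meet_dominated sep Si cS cA Sk.
have [SB|[c]] := set_0Vmem (S :&: B); last first.
  rewrite inE => /andP[cS cB].
  apply: (@separation_meet_dominated G B A S c) => //; split.
  - by rewrite disjoint_sym.
  - by move=> x y xB yA; rewrite edge_sym nAB.
  - by exists a.
  - by rewrite (addnC #|B|).
have SAF x : x \in S -> (x \in A) = false.
  by move=> xS; have /setP/(_ x) := SA; rewrite !inE xS.
have SBF x : x \in S -> (x \in B) = false.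
  by move=> xS; have /setP/(_ x) := SB; rewrite !inE xS.
have aw : a != w by apply: contraTneq aA => ->; rewrite SAF.
have wa : (w == a) = false by rewrite eq_sym (negPf aw).
apply: dominated_trans (kelmans_dominated f_sym f_Pstar aw) _.
pose K := kelmans a w.
have wA : (w \in A) = false by exact: SAF.
(* In [K] the vertex [w] has no neighbour in [B]: it keeps only neighbours shared with [a], besides
   possibly [a] itself. Putting [w] in place of [a] thus gives a separation of the same size that
   meets [S]. *)
apply: (@separation_meet_dominated K (w |: A :\ a) B S w) => //; last first.
- by rewrite !inE eqxx.
- apply/independentP => x y xS yS; move/independentP: Si => Si.
  rewrite /= /kelmans_rel /kelmans_moved.
  have [xa|_] := eqVneq x a; first by rewrite -xa SAF in aA.
  have [_|_] := eqVneq x w; first by rewrite Si.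
  have [ya|_] := eqVneq y a; first by rewrite -ya SAF in aA.
  by have [_|_] := eqVneq y w; rewrite Si.
split.
- rewrite finset.disjoints_subset; apply/fintype.subsetP => x; rewrite !inE.
  by case/predU1P => [->|/andP[_ xA]]; [rewrite SBF|rewrite (disjointFr dAB)].
- move=> x y; rewrite !inE => xwA yB.
  have ya : (y == a) = false.
    by apply: contraTF yB => /eqP ->; rewrite (disjointFr dAB).
  have yw : (y == w) = false by apply: contraTF yB => /eqP ->; rewrite SBF.
  rewrite /= /kelmans_rel /kelmans_moved ya yw /=.
  case/predU1P: xwA => [->|/andP[/negPf xa xA]].
    by rewrite wa eqxx (nAB a y aA yB) /= ?andbT andbN.
  have xw : (x == w) = false by apply: contraTF xA => /eqP ->; rewrite wA.
  by rewrite xa xw nAB.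
- by exists b.
- rewrite -cAB cardsU1 !inE wA andbF /=.
  by rewrite (cardsD1 a A) aA.
Qed.

End Separation.

(** * Minimum vertex cuts *)

Lemma vertex_connectivity_le (G : sgraph) (W : {set G}) :
  vertex_cut W -> (vertex_connectivity G <= #|W|)%N.
Proof.
by move=> cW; rewrite /vertex_connectivity -minEnat -leEnat; exact: bigmin_le_cond.
Qed.

Lemma card_delete (G : sgraph) (W : {set G}) : (#|delete W| + #|W|)%N = #|G|.
Proof.
rewrite card_sig -(cardsC W) addnC; congr (_ + _)%N.
by apply: eq_card => x; rewrite !inE.
Qed.

Lemma vertex_connectivity_lt (G : sgraph) :
  (0 < #|G|)%N -> (vertex_connectivity G < #|G|)%N.
Proof.
move=> /card_gt0P[x _]; have := card_delete (~: [set x]%SET).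
have := cardsC [set x]%SET; rewrite cards1 => cx cd.
have : (vertex_connectivity G <= #|~: [set x]%SET|)%N.
  by apply: vertex_connectivity_le; apply/orP; right; apply/eqP; lia.
by lia.
Qed.

Lemma vertex_connectivity_witness (G : sgraph) : (0 < #|G|)%N ->
  exists2 W : {set G}, vertex_cut W & #|W| = vertex_connectivity G.
Proof.
move=> /vertex_connectivity_lt.
(* The first alternative is the default value of the minimum, excluded by the strict bound just
   introduced. *)
have : vertex_connectivity G = #|G| \/
    exists2 W : {set G}, vertex_cut W & #|W| = vertex_connectivity G.
  rewrite /vertex_connectivity; elim/big_rec: _ => [|W k cW [kG|[W' cW' kW']]].
  - by left.
  - by rewrite /minn; case: ifP => _; [right; exists W|left].
  - by right; rewrite /minn; case: ifP => _; [exists W|exists W'].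
by case=> [->|//]; rewrite ltnn.
Qed.

(** Deleting the complement of an independent set with at least two vertices leaves a disconnected
    edgeless graph, so that complement is a vertex cut. *)
Lemma independent_connectivity_le (G : sgraph) (S : {set G}) : (0 < #|G|)%N ->
  independent S -> (#|S| + vertex_connectivity G <= #|G|)%N.
Proof.
move=> G0 /independentP Si.
have [S1|] := leqP #|S| 1; first by have := vertex_connectivity_lt G0; lia.
move=> /card_gt1P[x [y [xS yS xy]]].
have cS := cardsC S.
suff : vertex_cut (~: S) by move=> /vertex_connectivity_le; lia.
have xS' : x \notin ~: S by rewrite inE xS.
have yS' : y \notin ~: S by rewrite inE yS.
apply/orP; left; apply/existsP; exists (exist _ x xS').
apply/existsP; exists (exist _ y yS'); apply/negP => /connectP[[|z p] /=].
  by move=> _ [] yx; rewrite yx eqxx in xy.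
rewrite /del_rel /= Si//; by have := valP z; rewrite inE negbK.
Qed.

(** One side is the component of a vertex [x] that fails to reach some [y]; the other is all the
    rest. *)
Lemma disconnected_separation (G : sgraph) (W : {set G}) :
  disconnected_graph (delete W) ->
  exists A B : {set G}, separation #|W| A B /\ (0 < #|A|)%N.
Proof.
move=> /existsP[x /existsP[y xy]].
pose C := [set z | connect (@edge (delete W)) x z]%SET.
have valI : injective (val : delete W -> G) by exact: val_inj.
exists (val @: C), (val @: ~: C); split; last first.
  by apply/card_gt0P; exists (val x); apply: imset_f; rewrite inE.
split.
- rewrite -setI_eq0 -imsetI; last by move=> ? ? _ _; exact: valI.
  by rewrite finset.setICr imset0.
- move=> _ _ /imsetP[u uC ->] /imsetP[v vC ->]; apply/negP => uv.
  move: uC vC; rewrite !inE => xu /negP; apply.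
  by apply: connect_trans xu _; apply: connect1.
- by exists (val y); apply: imset_f; rewrite !inE.
- by rewrite !card_imset// cardsC card_delete.
Qed.

End Extremal.

Theorem theorem2p7 (R : realType) (f : R -> R -> R)
    (f_sym : symmetric_ge1 f) (f_Pstar : property_Pstar f)
    (n kappa beta0 : nat) (G : sgraph)
    (G_class : conn_indep_class n kappa beta0 G) :
  weighted_spectral_radius f G
    <= weighted_spectral_radius f (extremal_graph n kappa beta0)
  /\ (weighted_spectral_radius f G
        = weighted_spectral_radius f (extremal_graph n kappa beta0)
      <-> graph_iso G (extremal_graph n kappa beta0)).
Proof.
case: G_class => Gn Gc Gk Gb; have /andP[G0 _] := Gc.
suff [le eq] : dominated f G (extremal_graph n kappa beta0).
  split=> //; split=> [|iso]; first exact: eq.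
  apply/eqP; rewrite eq_le le /=.
  (* The inverse isomorphism is an edge-preserving bijection and gives the reverse inequality. *)
  have [g gb gm] := graph_iso_sym iso.
  have H0 : (0 < #|extremal_graph n kappa beta0|)%N by rewrite (bij_eq_card gb).
  by apply: (hom_dominated f_sym f_Pstar H0 gb _).1 => x y; rewrite gm.
have [S Si bS] : exists2 S : {set G}, independent S & #|S| = beta0.
  have I0 : independent (finset.set0 : {set G}).
    by apply/independentP => x y; rewrite inE.
  have cI : (0 < #|[pred S : {set G} | independent S]|)%N.
    by apply/card_gt0P; exists finset.set0.
  have [S Si ES] := eq_bigmax_cond (fun S : {set G} => #|S|) cI.
  by exists S => //; rewrite -Gb -ES.
have bmax (S' : {set G}) : independent S' -> (#|S'| <= beta0)%N.
  by move=> S'i; rewrite -Gb; exact: (leq_bigmax_cond (F := fun S : {set G} => #|S|)).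
have S0 : (0 < #|S|)%N.
  have /card_gt0P[x _] := G0; rewrite bS -(cards1 x); apply: bmax.
  by apply/independentP => y z; rewrite !inE => /eqP -> /eqP ->; rewrite edge_irr.
have Sk := independent_connectivity_le G0 Si.
have [W cW kW] := vertex_connectivity_witness G0.
rewrite -Gn -Gk -bS.
case/orP: cW => [/disconnected_separation[A [B [sep A0]]]|/eqP d1].
  rewrite kW in sep.
  exact: (separation_dominated f_sym f_Pstar sep A0 Si S0 Sk).
(* Here a single vertex survives the cut, so |G| = kappa + 1 and [S] itself is large enough to serve
   as [U]. *)
have [a aS] := card_gt0P S0.
have := card_delete W; rewrite d1 kW => cW.
apply: (@nonadjacent_dominated R f f_sym f_Pstar G _ S S a) => //.
  by move=> y yS; move/independentP: Si; apply.
by lia.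
Qed.
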